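(* Let $G$ be a finite connected graph, let $V\subset V(G)$ be a non-empty set of vertices, and let $\underline{d}$ be a ($\mathbb{Z}$-)divisor of degree $d$ on $G$. Then $\underline{d}$ is $V$-reduced if and only if there exists an $\mathbb{R}$-divisor $\mathcal{E}$ of degree $d$ supported on $V$ such that $\underline{d}$ is $\mathcal{E}$-reduced.
   Context: $G$ is a finite connected vertex-weighted graph, multiple edges and loops allowed, with vertex set $V(G)$. For $A=\mathbb{Z}$ or $\mathbb{R}$, an $A$-divisor is a formal sum $\mathcal{D}=\sum_{v\in V(G)}\mathcal{D}_v\, v$ with $\mathcal{D}_v\in A$; its degree is $\sum_v\mathcal{D}_v$. ''Divisor'' means $\mathbb{Z}$-divisor. An $A$-divisor is effective away from $V$ if its coefficients are $\ge 0$ at all $v\notin V$, and supported on $V$ if its coefficients are $0$ at all $v\notin V$. For $f:V(G)\to A$, $\mathrm{div}(f)$ is the $A$-divisor with $\mathrm{div}(f)_v=\sum_{e=vw}(f(w)-f(v))$, the sum over all edges $e$ adjacent to $v$ (loops contribute $0$). Two $\mathbb{Z}$-divisors are linearly equivalent ($\sim$) if they differ by $\mathrm{div}(f)$ with $f:V(G)\to\mathbb{Z}$. A chip-firing move along $W\subset V(G)$ replaces $\underline{d}$ by $\underline{d}+\mathrm{div}(\mathbb{1}_W)$, with $\mathbb{1}_W$ the characteristic function of $W$. $V$-reduced: $\underline{d}$ is $V$-reduced if it is effective away from $V$ and, for every non-empty $W\subset V(G)\setminus V$, the divisor $\underline{d}+\mathrm{div}(\mathbb{1}_W)$ is negative on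 at least one vertex of $W$. $\mathcal{E}$-reduced: for $\mathbb{R}$-divisors $\mathcal{E},\mathcal{D}$ of the same degree, $q_{\mathcal{E}}(\mathcal{D}):V(G)\to\mathbb{R}$ is the unique function with $\mathcal{E}=\mathcal{D}+\mathrm{div}(q_{\mathcal{E}}(\mathcal{D}))$ and minimal value $0$ (existence and uniqueness are known). Let $\mathcal{E}$ be an $\mathbb{R}$-divisor of degree $d$ supported on $V$. A divisor $\underline{d}$ of degree $d$ is $\mathcal{E}$-reduced (with respect to this $V$) if it is effective away from $V$ and $\sum_{v\in V(G)}q_{\mathcal{E}}(\underline{d})(v)$ is minimal among the values $\sum_{v\in V(G)}q_{\mathcal{E}}(\underline{d}')(v)$ over all divisors $\underline{d}'\sim\underline{d}$ that are effective away from $V$. *)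

(* Defs.v *)
From HB Require Import structures.
From mathcomp Require Import all_boot all_order all_algebra.
From mathcomp Require Import reals.
From mathcomp Require classical_sets.
From mathcomp Require Import ring lra.

Set Implicit Arguments.
Unset Strict Implicit.
Unset Printing Implicit Defensive.

Import Order.TTheory GRing.Theory Num.Theory.
Local Open Scope ring_scope.

(* The pair [src e, tgt e] is an arbitrary ordering of the two ends of the
   unoriented edge [e]; no definition below depends on this ordering.  A loop
   has [src e = tgt e]. *)
Record graph := Graph {
  vertex :> finType;
  edge : finType;
  src : edge -> vertex;
  tgt : edge -> vertex;
  weight : vertex -> nat
}.

Definition adjacent (G : graph) : rel G := fun v w =>
  [exists e : edge G, ((src e == v) && (tgt e == w))
                   || ((src e == w) && (tgt e == v))].

Definition connected_graph (G : graph) : Prop :=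
  (0 < #|G|)%N /\ (forall v w : G, connect (@adjacent G) v w).

(* An A-divisor on G is an element of [{ffun G -> A}]. *)

Definition degree (G : graph) (A : zmodType) (D : {ffun G -> A}) : A :=
  \sum_(v : G) D v.

Definition effective_away (G : graph) (A : numDomainType) (V : {set G})
    (D : {ffun G -> A}) : Prop :=
  forall v, v \notin V -> 0 <= D v.

Definition supported_on (G : graph) (A : zmodType) (V : {set G})
    (D : {ffun G -> A}) : Prop :=
  forall v, v \notin V -> D v = 0.

(* A non-loop edge at v occurs in exactly one of the two sums; a loop at v
   occurs in both and contributes 0 to each. *)
Definition div (G : graph) (A : zmodType) (f : {ffun G -> A}) : {ffun G -> A} :=
  [ffun v => \sum_(e : edge G | src e == v) (f (tgt e) - f v)
           + \sum_(e : edge G | tgt e == v) (f (src e) - f v)].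

Definition lin_equiv (G : graph) (D D' : {ffun G -> int}) : Prop :=
  exists f : {ffun G -> int}, D' = D + div f.

Definition indicator (G : graph) (W : {set G}) : {ffun G -> int} :=
  [ffun v => (v \in W)%:R].

Definition V_reduced (G : graph) (V : {set G}) (D : {ffun G -> int}) : Prop :=
  effective_away V D /\
  forall W : {set G}, W != set0 -> W \subset ~: V ->
    exists2 v, v \in W & (D + div (indicator W)) v < 0.

Definition real_div (R : realType) (G : graph) (D : {ffun G -> int}) :
    {ffun G -> R} :=
  [ffun v => (D v)%:~R].

Definition is_q (R : realType) (G : graph) (E D q : {ffun G -> R}) : Prop :=
  [/\ E = D + div q, (forall v, 0 <= q v) & (exists v, q v = 0)].

(* The function [q] satisfying [is_q E D q], which exists and is unique when G
   is connected and [degree E = degree D] (lemmas [q_funP] and [is_q_unique]);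
   the default value 0 is irrelevant in that case. *)
Definition q_fun (R : realType) (G : graph) (E D : {ffun G -> R}) :
    {ffun G -> R} :=
  classical_sets.xget 0 (is_q E D).

(* Used for E of the same degree as D and supported on V. *)
Definition E_reduced (R : realType) (G : graph) (V : {set G})
    (E : {ffun G -> R}) (D : {ffun G -> int}) : Prop :=
  effective_away V D /\
  forall D' : {ffun G -> int}, lin_equiv D D' -> effective_away V D' ->
    \sum_(v : G) q_fun E (real_div R D) v <=
    \sum_(v : G) q_fun E (real_div R D') v.

Lemma sum_mul_div (A : comPzRingType) (G : graph) (g f : {ffun G -> A}) :
  \sum_(v : G) g v * div f v =
  - \sum_(e : edge G) (g (tgt e) - g (src e)) * (f (tgt e) - f (src e)).
Proof.
have part (p q : edge G -> G) :
    \sum_(v : G) g v * (\sum_(e : edge G | p e == v) (f (q e) - f v)) =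
    \sum_(e : edge G) g (p e) * (f (q e) - f (p e)).
  rewrite [RHS](partition_big p xpredT) //=; apply: eq_bigr => v _.
  by rewrite mulr_sumr; apply: eq_bigr => e /eqP ->.
transitivity (\sum_(e : edge G) g (src e) * (f (tgt e) - f (src e))
            + \sum_(e : edge G) g (tgt e) * (f (src e) - f (tgt e))).
  rewrite -!part -big_split /=; apply: eq_bigr => v _.
  by rewrite ffunE mulrDr.
rewrite -big_split -sumrN /=; apply: eq_bigr => e _; ring.
Qed.

Lemma degree_div (A : comPzRingType) (G : graph) (f : {ffun G -> A}) :
  degree (div f) = 0.
Proof.
have := sum_mul_div [ffun=> 1] f.
under eq_bigr do rewrite ffunE mul1r.
by rewrite /degree => ->; rewrite big1 ?oppr0 // => e _; rewrite !ffunE subrr mul0r.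
Qed.

Lemma div_eq0 (R : realDomainType) (G : graph) (f : {ffun G -> R}) :
  connected_graph G -> div f = 0 -> forall v w, f v = f w.
Proof.
move=> [_ conG] f0 v w.
have edge_eq (e : edge G) : f (tgt e) = f (src e).
  have /eqP := sum_mul_div f f.
  rewrite f0 big1 => [|u _]; last by rewrite ffunE mulr0.
  rewrite eq_sym oppr_eq0 psumr_eq0 => [|i _]; last by rewrite -expr2 sqr_ge0.
  move=> /allP /(_ e (mem_index_enum _)) /=.
  by rewrite -expr2 sqrf_eq0 subr_eq0 => /eqP.
have /connectP[p] := conG v w.
elim: p v => [|x p IHp] v /= => [_ ->//|/andP[/existsP[e vx] xp] wE].
rewrite -(IHp _ xp wE).
by case/orP: vx => /andP[/eqP <- /eqP <-]; rewrite edge_eq.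
Qed.

Lemma divB (A : zmodType) (G : graph) (f g : {ffun G -> A}) :
  div (f - g) = div f - div g.
Proof.
apply/ffunP => v; rewrite !ffunE [in RHS]opprD addrACA -!sumrB.
by congr (_ + _); apply: eq_bigr => e _; rewrite !ffunE !opprD !opprK addrACA.
Qed.

Lemma is_q_unique (R : realType) (G : graph) (E D q q' : {ffun G -> R}) :
  connected_graph G -> is_q E D q -> is_q E D q' -> q = q'.
Proof.
move=> conG [Eq qge0 [v0 qv0]] [Eq' q'ge0 [w0 q'w0]].
have /(div_eq0 conG) qq' : div (q - q') = 0.
  have dqq' : div q = div q' by apply: (addrI D); rewrite -Eq.
  by rewrite divB dqq' subrr.
apply/ffunP => v; have := qq' v v0; have := qq' v w0; rewrite !ffunE.
by have := qge0 w0; have := q'ge0 v0; lra.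
Qed.

Lemma q_funP (R : realType) (G : graph) (E D : {ffun G -> R}) :
  connected_graph G -> degree E = degree D -> is_q E D (q_fun E D).
Proof.
move=> conG degED; apply: classical_sets.xgetPex.
have [/card_gt0P[v0 _] _] := conG.
(* The map f |-> div f + (sum of f) is injective, hence surjective. *)
pose F (f : {ffun G -> R^o}) : {ffun G -> R^o} :=
  [ffun v => div f v + degree f].
have degF f : degree (F f) = degree f *+ #|G|.
  rewrite /degree; under eq_bigr do rewrite ffunE.
  by rewrite big_split /= -/(degree _) degree_div add0r sumr_const.
have F_linear : linear F.
  move=> a f g; apply/ffunP => v.
  have sumL (I : finType) (P : pred I) (x y z : I -> R) :
      (forall i, z i = a * x i + y i) ->
      \sum_(i | P i) z i = a * (\sum_(i | P i) x i) + \sum_(i | P i) y i.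
    move=> zE; rewrite mulr_sumr -big_split /=.
    by apply: eq_bigr => i _; rewrite zE.
  have aux (b x y z w : R) : b * x + z - (b * y + w) = b * (x - y) + (z - w).
    by ring.
  have aux3 (b x1 x2 x3 y1 y2 y3 : R) :
      b * x1 + y1 + (b * x2 + y2) + (b * x3 + y3) =
      b * (x1 + x2 + x3) + (y1 + y2 + y3) by ring.
  have lin u : (a *: f + g) u = a * f u + g u by rewrite !ffunE.
  transitivity (a * F f v + F g v); last by rewrite !ffunE.
  rewrite /F !ffunE /degree (sumL _ _ f g);
    last exact: lin.
  rewrite (sumL _ (fun e => src e == v) (fun e => f (tgt e) - f v)
    (fun e => g (tgt e) - g v)); last by move=> e; rewrite lin; exact: aux.
  rewrite (sumL _ (fun e => tgt e == v) (fun e => f (src e) - f v)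
    (fun e => g (src e) - g v)); last by move=> e; rewrite lin; exact: aux.
  exact: aux3.
pose FL := GRing.isLinear.Build R _ _ _ F F_linear.
pose Flin : {linear {ffun G -> R^o} -> {ffun G -> R^o}} := HB.pack F FL.
have cardN0 : #|G|%:R != 0 :> R by rewrite pnatr_eq0 -lt0n; case: conG.
have degF0 f : degree (F f) = 0 -> degree f = 0.
  by rewrite degF -mulr_natr => /eqP; rewrite mulf_eq0 (negPf cardN0) orbF => /eqP.
have ker0 : lker (linfun Flin) == 0%VS.
  rewrite -subv0; apply/subvP => f; rewrite memv_ker lfunE /= memv0 => /eqP Ff0.
  have degf0 : degree f = 0.
    by apply: degF0; rewrite Ff0 /degree big1 // => v _; rewrite ffunE.
  have /(div_eq0 conG) fE : div f = 0.
    by apply/ffunP => v; move/ffunP/(_ v): Ff0; rewrite ffunE degf0 addr0.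
  apply/eqP/ffunP => v; rewrite ffunE; move: degf0; rewrite /degree.
  under eq_bigr do rewrite (fE _ v).
  rewrite sumr_const -mulr_natr => /eqP.
  by rewrite mulf_eq0 (negPf cardN0) orbF => /eqP.
have : (E - D : {ffun G -> R^o}) \in limg (linfun Flin).
  by rewrite (lker0_limgf ker0) memvf.
move=> /memv_imgP[f _]; rewrite lfunE /= => EDf.
have degf0 : degree f = 0.
  apply: degF0; rewrite -EDf /degree.
  under eq_bigr do rewrite !ffunE.
  by rewrite sumrB; apply/eqP; rewrite subr_eq0; apply/eqP.
pose m := [arg min_(v < v0) (f v : R)]%O.
exists [ffun v => f v - f m]; split.
- apply/ffunP => v; move/ffunP/(_ v): EDf; rewrite !ffunE degf0 addr0 => /eqP.
  rewrite subr_eq addrC => /eqP ->; congr (_ + _).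
  by congr (_ + _); apply: eq_bigr => e _; rewrite !ffunE; ring.
- move=> v; rewrite ffunE subr_ge0 /m.
  by case: arg_minP => // i _; apply.
- by exists m; rewrite ffunE subrr.
Qed.

(* Main.v *)
Require Import Defs.
From mathcomp Require Import all_boot all_order all_algebra.
From mathcomp Require Import reals.
From HB Require Import structures.
From mathcomp Require classical_sets.
From mathcomp Require Import zify.

Set Implicit Arguments.
Unset Strict Implicit.

Import Order.TTheory GRing.Theory Num.Theory.
Local Open Scope ring_scope.

(** If [div f <= 0] off [V], then [f] attains its minimum on [V].

    Suppose [D] is [V]-reduced.  Solve the Dirichlet problem [h = 0] on [V],
    [div h = - D] off [V], and put [E = D + div h].  Then [h >= 0], so
    [h = q_E(D)].  If [D + div f] is effective away from [V], reducedness of [D]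
    applied to the set where [f] is maximal forces [f] to attain its maximum [M]
    on [V]; hence [q_E(D + div f) = h + (M - f) >= h].

    Conversely, if [D] is [E]-reduced but [D + div 1_W] is nonnegative on some
    non-empty [W] disjoint from [V], then [q_E(D) - 1_W] still attains its
    minimum on [V], where it agrees with [q_E(D)]; so it is [q_E(D + div 1_W)],
    whose sum is smaller than that of [q_E(D)]. *)

(** Linearity in pointwise form, so that it applies directly to the [R^o]-valued functions in
    [dirichlet]. *)
Lemma div_scale_add (A : pzRingType) (G : graph) (a : A)
    (f g h : {ffun G -> A}) :
  (forall v, h v = a * f v + g v) ->
  forall v, div h v = a * div f v + div g v.
Proof.
move=> hE v; rewrite !ffunE mulrDr addrACA !mulr_sumr -!big_split /=.
by congr (_ + _); apply: eq_bigr => e _; rewrite !hE mulrBr opprD addrACA.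
Qed.

Lemma divD (A : zmodType) (G : graph) (f g : {ffun G -> A}) :
  div (f + g) = div f + div g.
Proof. by apply/eqP; rewrite -subr_eq -divB addrK. Qed.

Lemma divN (A : zmodType) (G : graph) (f : {ffun G -> A}) :
  div (- f) = - div f.
Proof. by apply: (addrI (div f)); rewrite -divD -divB. Qed.

Lemma div_const (A : zmodType) (G : graph) (c : A) :
  div ([ffun=> c] : {ffun G -> A}) = 0.
Proof.
by apply/ffunP => v; rewrite !ffunE !big1 ?addr0 // => e _; rewrite !ffunE subrr.
Qed.

Lemma le_div (A : numDomainType) (G : graph) (f g : {ffun G -> A}) (v : G) :
  (forall w, f w - f v <= g w - g v) -> div f v <= div g v.
Proof. by move=> fg; rewrite !ffunE lerD // ler_sum. Qed.

(** At a minimum every difference summed in [div f v] is nonnegative, so a nonpositive total makes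
    each of them vanish. *)
Lemma div_le0_at_min (A : numDomainType) (G : graph) (f : {ffun G -> A})
    (v w : G) :
  (forall u, f v <= f u) -> div f v <= 0 -> adjacent v w -> f w = f v.
Proof.
move=> fmin; rewrite ffunE => divf /existsP[e vw].
have src0 : 0 <= \sum_(e : edge G | src e == v) (f (tgt e) - f v).
  by apply: sumr_ge0 => i _; rewrite subr_ge0.
have tgt0 : 0 <= \sum_(e : edge G | tgt e == v) (f (src e) - f v).
  by apply: sumr_ge0 => i _; rewrite subr_ge0.
have /eqP : \sum_(e : edge G | src e == v) (f (tgt e) - f v)
          + \sum_(e : edge G | tgt e == v) (f (src e) - f v) = 0.
  by apply/le_anti; rewrite divf addr_ge0.
rewrite paddr_eq0 // !psumr_eq0; try by move=> i _; rewrite subr_ge0.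
move=> /andP[/allP/(_ e (mem_index_enum _)) /= s0].
move=> /allP/(_ e (mem_index_enum _)) /= t0.
case/orP: vw => /andP[/eqP ve /eqP we].
  by move: s0; rewrite ve we eqxx subr_eq0 => /eqP.
by move: t0; rewrite ve we eqxx subr_eq0 => /eqP.
Qed.

Lemma minimum_principle (A : realDomainType) (G : graph) (V : {set G})
    (f : {ffun G -> A}) :
  connected_graph G -> V != set0 -> (forall v, v \notin V -> div f v <= 0) ->
  exists2 v, v \in V & forall w, f v <= f w.
Proof.
move=> [_ conG] /set0Pn[v0 v0V] divf.
have [m _ mmin] := arg_minP (fun v => f v) (erefl : xpredT v0).
have {}mmin w : f m <= f w by exact: mmin.
(* Walk from a minimizer towards [v0]: as long as the current vertex is outside [V],
   [div_le0_at_min] makes the next vertex a minimizer too. *)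
have /connectP[p] := conG m v0.
elim: p m mmin => [|x p IHp] m mmin /=; first by move=> _ v0m; exists m; rewrite // -v0m.
move=> /andP[mx xp] v0E.
have [mV|mV] := boolP (m \in V); first by exists m.
apply: (IHp x) => // w.
by rewrite (div_le0_at_min mmin (divf _ mV) mx).
Qed.

Lemma minimum_principle_ge0 (A : realDomainType) (G : graph) (V : {set G})
    (f : {ffun G -> A}) :
  connected_graph G -> V != set0 -> (forall v, v \notin V -> div f v <= 0) ->
  (forall v, v \in V -> 0 <= f v) -> forall v, 0 <= f v.
Proof.
move=> conG V0 divf fV v.
have [w wV wmin] := minimum_principle conG V0 divf.
exact: le_trans (fV w wV) (wmin v).
Qed.

(** The data [g] prescribes values on [V] and divergences off [V]. The map [F] is a linear
    endomorphism of a finite-dimensional space, so injectivity gives surjectivity. *)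
Lemma dirichlet (R : realFieldType) (G : graph) (V : {set G})
    (g : {ffun G -> R}) :
  connected_graph G -> V != set0 ->
  exists h : {ffun G -> R},
    forall v, if v \in V then h v = g v else div h v = g v.
Proof.
move=> conG V0.
pose F (f : {ffun G -> R^o}) : {ffun G -> R^o} :=
  [ffun v => if v \in V then f v else div f v].
have F_linear : linear F.
  move=> a f k; apply/ffunP => v.
  rewrite [LHS]ffunE [RHS]ffunE [(a *: F f) v]ffunE [F f v]ffunE [F k v]ffunE.
  have lin u : (a *: f + k) u = a * f u + k u by rewrite !ffunE.
  case: ifP => _; first exact: lin.
  exact: (div_scale_add lin).
pose FL := GRing.isLinear.Build R _ _ _ F F_linear.
pose Flin : {linear {ffun G -> R^o} -> {ffun G -> R^o}} := HB.pack F FL.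
have ker0 : lker (linfun Flin) == 0%VS.
  rewrite -subv0; apply/subvP => f; rewrite memv_ker lfunE /= memv0 => /eqP Ff0.
  have FfE v : (if v \in V then f v else div f v) = 0.
    by move/ffunP/(_ v): Ff0; rewrite !ffunE.
  apply/eqP/ffunP => v; rewrite [RHS]ffunE.
  (* A kernel element is 0 on [V] and has zero divergence off [V], so the minimum principle applies
     both to [- f] and to [f]. *)
  apply/le_anti/andP; split.
    rewrite -oppr_ge0.
    have := @minimum_principle_ge0 R G V (- f : {ffun G -> R}) conG V0.
    move=> /(_ _ _ v); rewrite ffunE; apply=> w wV.
      by rewrite divN ffunE; have := FfE w; rewrite (negPf wV) => ->; rewrite oppr0.
    by rewrite ffunE; have := FfE w; rewrite wV => ->; rewrite oppr0.
  apply: (@minimum_principle_ge0 R G V f conG V0) => w wV.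
    by have := FfE w; rewrite (negPf wV) => ->.
  by have := FfE w; rewrite wV => ->.
have : (g : {ffun G -> R^o}) \in limg (linfun Flin).
  by rewrite (lker0_limgf ker0) memvf.
move=> /memv_imgP[h _]; rewrite lfunE /= => gE.
by exists h => v; move/ffunP/(_ v): gE; rewrite ffunE; case: ifP.
Qed.

Lemma real_div_add_div (R : realType) (G : graph) (D f : {ffun G -> int}) :
  real_div R (D + div f) = real_div R D + div (real_div R f).
Proof.
apply/ffunP => v; rewrite !ffunE !rmorphD /= !rmorph_sum /=.
by congr (_ + (_ + _)); apply: eq_bigr => e _; rewrite !ffunE rmorphB.
Qed.

Lemma degree_real_div (R : realType) (G : graph) (D : {ffun G -> int}) :
  degree (real_div R D) = (degree D)%:~R.
Proof. by rewrite /degree rmorph_sum; apply: eq_bigr => v _; rewrite ffunE. Qed.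

Lemma q_funE (R : realType) (G : graph) (E D q : {ffun G -> R}) :
  connected_graph G -> is_q E D q -> q_fun E D = q.
Proof.
move=> conG Eq; apply: (is_q_unique conG _ Eq).
by apply: classical_sets.xgetPex; exists q.
Qed.

Lemma V_reduced_max (G : graph) (V : {set G}) (D f : {ffun G -> int}) :
  connected_graph G -> V_reduced V D -> effective_away V (D + div f) ->
  exists2 v, v \in V & forall w, f w <= f v.
Proof.
move=> [/card_gt0P[v0 _] _] [_ redD] effD'.
have [m _ mmax] := arg_maxP (fun v => f v) (erefl : xpredT v0).
have {}mmax w : f w <= f m by exact: mmax.
pose W := [set v | f v == f m].
have [WV|/subsetPn[v vW]] := boolP (W \subset ~: V); last first.
  rewrite inE negbK => vV; exists v => //.
  by move: vW; rewrite inE => /eqP ->.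
have W0 : W != set0 by apply/set0Pn; exists m; rewrite inE.
have [v vW] := redD W W0 WV; rewrite ffunE ltNge => /negP[].
have vV : v \notin V by have := subsetP WV v vW; rewrite inE.
have := effD' v vV; rewrite ffunE => /le_trans; apply.
(* Integrality enters here: off [W], [f] is at most [f m - 1], so it drops at least as much as the
   indicator does. *)
rewrite lerD2l; apply: le_div => w; rewrite 2!ffunE vW inE.
move: vW; rewrite inE => /eqP ->.
have := mmax w; case: eqP => /= [->|]; lia.
Qed.

Lemma V_reduced_E_reduced (R : realType) (G : graph) (V : {set G})
    (D : {ffun G -> int}) :
  connected_graph G -> V != set0 -> V_reduced V D ->
  exists E : {ffun G -> R},
    [/\ degree E = (degree D)%:~R, supported_on V E & E_reduced V E D].
Proof.
move=> conG V0 redD; have effD := redD.1.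
have [h hE] := @dirichlet R G V
  [ffun v => if v \in V then 0 else - (D v)%:~R] conG V0.
have hV v : v \in V -> h v = 0 by move=> vV; have := hE v; rewrite ffunE vV.
have hNV v : v \notin V -> div h v = - (D v)%:~R.
  by move=> /negPf vV; have := hE v; rewrite ffunE vV.
have h0 : forall v, 0 <= h v.
  apply: (minimum_principle_ge0 conG V0) => v vV; last by rewrite hV.
  by rewrite hNV // oppr_le0 ler0z effD.
have [v0 v0V] := set0Pn _ V0.
exists (real_div R D + div h); split.
- rewrite -degree_real_div /degree.
  under eq_bigr do rewrite ffunE.
  by rewrite big_split /= -!/(degree _) degree_div addr0.
- by move=> v vV; rewrite ffunE hNV // ffunE subrr.
split=> // _ [f ->] effD'.
have [m mV mmax] := V_reduced_max conG redD effD'.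
rewrite (_ : q_fun _ _ = h); last first.
  by apply: q_funE => //; split=> //; exists v0; apply: hV.
(* Subtracting [f] compensates for [div f]; the constant [f m] brings the minimum back to 0,
   attained at [m], where [h] vanishes. *)
rewrite (_ : q_fun _ _ = h - real_div R f + [ffun=> (f m)%:~R]); last first.
  apply: q_funE => //; split.
  - by rewrite real_div_add_div divD divB div_const addr0 -addrA subrKC.
  - by move=> v; rewrite !ffunE -addrA addr_ge0 // addrC subr_ge0 ler_int.
  - by exists m; rewrite !ffunE hV // sub0r addNr.
apply: ler_sum => v _.
by rewrite !ffunE -addrA lerDl addrC subr_ge0 ler_int.
Qed.

Lemma E_reduced_V_reduced (R : realType) (G : graph) (V : {set G})
    (D : {ffun G -> int}) (E : {ffun G -> R}) :
  connected_graph G -> V != set0 -> degree E = (degree D)%:~R ->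
  supported_on V E -> E_reduced V E D -> V_reduced V D.
Proof.
move=> conG V0 degE suppE [effD minD]; split=> // W W0 WV.
apply/exists_inP; apply: contraT; rewrite negb_exists_in => /forall_inP Wge0.
pose D' := D + div (indicator W).
have effD' : effective_away V D'.
  move=> v vV; have [vW|vW] := boolP (v \in W); first by rewrite leNgt Wge0.
  (* Firing [W] removes no chips from a vertex outside [W]: compare the indicator with the zero
     function at [v]. *)
  rewrite ffunE addr_ge0 ?effD // -[0](_ : div [ffun=> 0] v = 0).
    by apply: le_div => w; rewrite !ffunE (negPf vW) !subr0 ler0n.
  by rewrite div_const ffunE.
have [EDq q0 [z qz]] := q_funP conG (etrans degE (esym (degree_real_div R D))).
set q := q_fun E (real_div R D) in EDq q0 qz.
pose r := q - real_div R (indicator W).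
have EDr : E = real_div R D' + div r.
  by rewrite real_div_add_div divB -addrA subrKC.
(* Since [E] vanishes off [V], there [div q] is [- D] and [div r] is [- D'], both nonpositive. *)
have [m mV mmin] : exists2 v, v \in V & forall w, q v <= q w.
  apply: minimum_principle => // v vV.
  by have /ffunP/(_ v) := EDq; rewrite 2!ffunE suppE // => /eqP;
    rewrite eq_sym addrC addr_eq0 => /eqP ->; rewrite oppr_le0 ler0z effD.
have [n nV nmin] : exists2 v, v \in V & forall w, r v <= r w.
  apply: minimum_principle => // v vV.
  by have /ffunP/(_ v) := EDr; rewrite 2!ffunE suppE // => /eqP;
    rewrite eq_sym addrC addr_eq0 => /eqP ->; rewrite oppr_le0 ler0z effD'.
have rV v : v \in V -> r v = q v.
  move=> vV; rewrite !ffunE (_ : v \in W = false) ?subr0 //.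
  by apply/negP => /(subsetP WV); rewrite inE vV.
have qm : q m = 0 by apply/le_anti; rewrite q0 andbT -qz mmin.
have r_is_q : is_q E (real_div R D') r.
  split=> //; last by exists m; rewrite rV.
  by move=> v; apply: le_trans (nmin v); rewrite rV.
have := minD D' (ex_intro _ _ erefl) effD'.
rewrite (q_funE conG r_is_q) -/q leNgt => /negP[].
have [w wW] := set0Pn _ W0.
(* The inequality is strict at [w], where [r] is [q - 1]; elsewhere [r] is at most [q]. *)
rewrite (bigD1 w) //= [ltRHS](bigD1 w) //=; apply: ltr_leD.
  by rewrite !ffunE wW gtrBl ltr01.
by apply: ler_sum => v _; rewrite !ffunE gerBl ler0z ler0n.
Qed.

Theorem theoremA (R : realType) (G : graph) (V : {set G})
    (D : {ffun G -> int}) :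
  connected_graph G -> V != set0 ->
  (V_reduced V D <->
   exists E : {ffun G -> R},
     [/\ degree E = (degree D)%:~R, supported_on V E & E_reduced V E D]).
Proof.
move=> conG V0; split; first exact: V_reduced_E_reduced.
by move=> [E []]; apply: E_reduced_V_reduced.
Qed.
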